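(* Let $n \geq 2$ be an integer, let $A$ and $B$ be $C^*$-algebras, and let $\phi : A \to B$ be a map. Then $\phi$ is a positive $n$-homomorphism if and only if $\phi$ is a $*$-homomorphism.
   Context: An $n$-homomorphism between algebras $A$ and $B$ is a linear map $\phi : A \to B$ with $\phi(a_1 a_2 \cdots a_n) = \phi(a_1)\phi(a_2)\cdots\phi(a_n)$ for all $a_1,\dots,a_n \in A$. A linear map $\phi : A \to B$ between $C^*$-algebras is positive if $a \geq 0$ implies $\phi(a) \geq 0$. The $C^*$-algebras are not assumed unital. *)

(* Defs.v *)
From HB Require Import structures.
From mathcomp Require Import all_boot all_order all_algebra.
From mathcomp Require Import complex.
From mathcomp Require Import all_classical reals topology normedtype.

Set Implicit Arguments.
Unset Strict Implicit.
Unset Printing Implicit Defensive.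

Import Order.TTheory GRing.Theory Num.Theory.
Import numFieldNormedType.Exports.

Local Open Scope ring_scope.
Local Open Scope complex_scope.

(* C*-algebras, not assumed unital: MathComp rings all have a unit, so the
   product is added on top of a complex Banach space. The norm takes its values
   in [R[i]], where [0 <= z] means that [z] is real and nonnegative. *)
HB.mixin Record isCstarAlgebra (R : realType) (A : Type)
    of CompleteNormedModule R[i] A := {
  cmul : A -> A -> A;
  star : A -> A;
  cmulA : forall x y z : A, cmul x (cmul y z) = cmul (cmul x y) z;
  cmulDl : forall x y z : A, cmul (x + y) z = cmul x z + cmul y z;
  cmulDr : forall x y z : A, cmul x (y + z) = cmul x y + cmul x z;
  cscalerAl : forall (c : R[i]) (x y : A), c *: cmul x y = cmul (c *: x) y;
  cscalerAr : forall (c : R[i]) (x y : A), c *: cmul x y = cmul x (c *: y);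
  cnormM : forall x y : A, `|cmul x y| <= `|x| * `|y|;
  starK : forall x : A, star (star x) = x;
  starD : forall x y : A, star (x + y) = star x + star y;
  starZ : forall (c : R[i]) (x : A), star (c *: x) = Num.conj c *: star x;
  starM : forall x y : A, star (cmul x y) = cmul (star y) (star x);
  cstar_identity : forall x : A, `|cmul (star x) x| = `|x| ^+ 2
}.

#[short(type="cstarAlgType")]
HB.structure Definition CstarAlgebra (R : realType) :=
  {A of isCstarAlgebra R A & CompleteNormedModule R[i] A}.

Section CstarDefs.
Context {R : realType}.
Implicit Types A B : cstarAlgType R.

(* The unitization of [A]: the pair [(a, c)] stands for [a + c 1]. *)
Definition unitization A : Type := (A * R[i])%type.

Definition uone A : unitization A := (0, 1).

Definition umul A (u v : unitization A) : unitization A :=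
  (cmul u.1 v.1 + v.2 *: u.1 + u.2 *: v.1, u.2 * v.2).

Definition uinvertible A (u : unitization A) : Prop :=
  exists v : unitization A, umul u v = uone A /\ umul v u = uone A.

(* The spectrum is computed in the unitization even if [A] happens to have a
   unit; this only adds the point [0] to the spectrum relative to [A], so it
   does not affect positivity. *)
Definition spectrum A (a : A) : set R[i] :=
  [set c : R[i] | ~ uinvertible ((- a, c) : unitization A)]%classic.

Definition cpositive A (a : A) : Prop :=
  star a = a /\ forall c : R[i], spectrum a c -> 0 <= c.

Definition positive_map A B (phi : A -> B) : Prop :=
  linear phi /\ forall a : A, cpositive a -> cpositive (phi a).

(* [a_1 a_2 ... a_n]; the value on the empty sequence is a dummy. *)
Definition cprod A (s : seq A) : A :=
  if s is a :: s' then foldl cmul a s' else 0.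

Definition n_homomorphism (n : nat) A B (phi : A -> B) : Prop :=
  linear phi /\
  forall a : n.-tuple A, phi (cprod a) = cprod [seq phi x | x <- a].

Definition star_homomorphism A B (phi : A -> B) : Prop :=
  [/\ linear phi,
      forall x y : A, phi (cmul x y) = cmul (phi x) (phi y)
    & forall x : A, phi (star x) = star (phi x)].

End CstarDefs.

(* Main.v *)
(* A positive map preserves the involution because every self-adjoint c is half
   the difference of the positive elements |c| + c and |c| - c.  Here |c| is the
   square root of c^2, obtained from the binomial series of sqrt(1 - x), which
   converges in norm for |x| <= 1; that 1 - c^2 is a contraction when |c| <= 1
   follows from the unitary c + i sqrt(1 - c^2).

   For multiplicativity put N = n - 1, l >= 0, k = l^n, L = phi(k) and
   Y = phi(k^2).  An n-homomorphism also respects products of 1 + jN factors,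
   whence L and Y commute and Y^N L = L^(2N+1).  Both are self-adjoint and
   Y >= 0, so uniqueness of positive N-th roots gives Y L^N = L^(N+2).  Regrouping
   the factors of x k^(3N) z then gives phi(x k^(3N) z) = phi(x) phi(k^(3N) z).
   Every positive y has the form k^(3N) z with l an iterated square root of y,
   and the positive elements span A. *)
Require Import Defs.
From HB Require Import structures.
From mathcomp Require Import all_boot all_order all_algebra.
From mathcomp Require Import complex zify ring lra.
From mathcomp Require Import all_classical reals topology normedtype sequences.
Set Implicit Arguments.
Unset Strict Implicit.
Unset Printing Implicit Defensive.

Import Order.TTheory GRing.Theory Num.Theory.
Import numFieldNormedType.Exports.

Local Open Scope ring_scope.
Local Open Scope complex_scope.

(** * The norm as a real number *)

Section RealNorm.
Context {R : realType}.

Definition rnorm (V : normedZmodType R[i]) (x : V) : R := complex.Re `|x|.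

Section Generic.
Variable V : normedZmodType R[i].
Implicit Types x y : V.

Lemma rnormE x : `|x| = (rnorm x)%:C.
Proof.
have /eqP := normr_ge0 x; rewrite /rnorm lecE /= => /eqP/andP[/eqP im0 _].
by case: `|x| im0 => a b /= ->.
Qed.

Lemma rnorm_ge0 x : 0 <= rnorm x.
Proof. by rewrite -lecR -rnormE normr_ge0. Qed.

Lemma rnormD x y : rnorm (x + y) <= rnorm x + rnorm y.
Proof. by rewrite -lecR rmorphD /= -!rnormE ler_normD. Qed.

Lemma rnormN x : rnorm (- x) = rnorm x.
Proof. by rewrite /rnorm normrN. Qed.

Lemma rnorm0 : rnorm (0 : V) = 0.
Proof. by rewrite /rnorm normr0. Qed.

Lemma rnorm_le0 x : rnorm x <= 0 -> x = 0.
Proof.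
by move=> h; apply/eqP; rewrite -normr_le0 rnormE -(rmorph0 (real_complex R)) lecR.
Qed.
End Generic.

Lemma rnormZ (V : normedModType R[i]) (c : R[i]) (x : V) :
  rnorm (c *: x) = rnorm c * rnorm x.
Proof. by apply: complexI; rewrite rmorphM /= -!rnormE normrZ. Qed.

Lemma rnormM (c d : R[i]) : rnorm (c * d) = rnorm c * rnorm d.
Proof. by apply: complexI; rewrite rmorphM /= -!rnormE normrM. Qed.

Lemma rnormV (c : R[i]) : rnorm c^-1 = (rnorm c)^-1.
Proof. by apply: complexI; rewrite fmorphV /= -!rnormE normfV. Qed.

Lemma rnormR (r : R) : rnorm r%:C = `|r|.
Proof. by rewrite /rnorm normc_def /= expr0n /= addr0 sqrtr_sqr. Qed.

Lemma rnorm1 : rnorm (1 : R[i]) = 1.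
Proof. by rewrite -[1 : R[i]]/(1%:C) rnormR normr1. Qed.

Lemma rnorm_conj (c : R[i]) : rnorm (Num.conj c) = rnorm c.
Proof. by rewrite /rnorm norm_conjC. Qed.

Lemma rnorm_sqr (c : R[i]) : rnorm c ^+ 2 = complex.Re c ^+ 2 + complex.Im c ^+ 2.
Proof. by rewrite /rnorm normc_def /= sqr_sqrtr // addr_ge0 ?sqr_ge0. Qed.

Variable A : cstarAlgType R.
Implicit Types x y : A.

Lemma rnorm_cmul x y : rnorm (cmul x y) <= rnorm x * rnorm y.
Proof. by rewrite -lecR rmorphM /= -!rnormE cnormM. Qed.

Lemma rnorm_cstar x : rnorm (cmul (star x) x) = rnorm x ^+ 2.
Proof. by apply: complexI; rewrite rmorphXn /= -!rnormE cstar_identity. Qed.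

(** The C*-identity gives [|y|^2 <= |star y| |y|], hence [|y| <= |star y|]; the same bound at
    [star y] gives the converse. *)
Lemma rnorm_star x : rnorm (star x) = rnorm x.
Proof.
suff le y : rnorm y <= rnorm (star y).
  by apply/le_anti/andP; split; [rewrite -{2}[x]starK; exact: le | exact: le].
have := rnorm_cmul (star y) y; rewrite rnorm_cstar.
have := rnorm_ge0 y; rewrite le_eqVlt => /predU1P[<- _|y0]; first exact: rnorm_ge0.
by rewrite expr2 ler_pM2r.
Qed.

End RealNorm.

(** * The unitization as an algebra *)

Section Unitization.
Context {R : realType} (A : cstarAlgType R).

Lemma cmul0 (x : A) : cmul x 0 = 0.
Proof. by rewrite -(scale0r (0 : A)) -cscalerAr !scale0r. Qed.

Lemma cmul0l (x : A) : cmul 0 x = 0.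
Proof. by rewrite -(scale0r (0 : A)) -cscalerAl !scale0r. Qed.

HB.instance Definition _ :=
  GRing.Lmodule.copy (unitization A) (A * (R[i])^o)%type.

Lemma umulA : associative (@umul R A).
Proof.
move=> [a c] [b d] [e f]; rewrite /umul /=; congr pair; last by rewrite mulrA.
rewrite !cmulDl !cmulDr !scalerDr -!cscalerAl -!cscalerAr cmulA !scalerA.
rewrite -!addrA; congr (_ + _); rewrite [f * d]mulrC [f * c]mulrC.
rewrite addrCA; congr (_ + _); rewrite [RHS]addrCA; congr (_ + _).
by rewrite [RHS]addrCA; congr (_ + _); rewrite addrCA.
Qed.

Lemma umul1l : left_id (uone A) (@umul R A).
Proof.
by move=> [a c]; rewrite /umul /= cmul0l scaler0 scale1r mul1r !add0r.
Qed.

Lemma umul1r : right_id (uone A) (@umul R A).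
Proof.
by move=> [a c]; rewrite /umul /= cmul0 scaler0 scale1r mulr1 add0r addr0.
Qed.

Lemma umulDl : left_distributive (@umul R A) +%R.
Proof.
move=> [a c] [b d] [e f]; rewrite /umul /=; congr pair; last exact: mulrDl.
by rewrite /= cmulDl scalerDr scalerDl [RHS]addrACA; congr (_ + _); rewrite addrACA.
Qed.

Lemma umulDr : right_distributive (@umul R A) +%R.
Proof.
move=> [a c] [b d] [e f]; rewrite /umul /=; congr pair; last exact: mulrDr.
by rewrite /= cmulDr scalerDr scalerDl [RHS]addrACA; congr (_ + _); rewrite addrACA.
Qed.

Lemma uone_neq0 : uone A != 0.
Proof. by apply/eqP=> -[] /eqP; rewrite oner_eq0. Qed.

HB.instance Definition _ := GRing.Zmodule_isNzRing.Build (unitization A)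
  umulA umul1l umul1r umulDl umulDr uone_neq0.

Lemma uscalerAl (c : R[i]) (u v : unitization A) : c *: (u * v) = (c *: u) * v.
Proof.
case: u v => [a d] [b e]; apply: injective_projections => /=; last first.
  by rewrite [LHS]mulrA.
by rewrite !scalerDr cscalerAl !scalerA (mulrC e c).
Qed.

HB.instance Definition _ :=
  GRing.Lmodule_isLalgebra.Build R[i] (unitization A) uscalerAl.

Lemma uscalerAr (c : R[i]) (u v : unitization A) : c *: (u * v) = u * (c *: v).
Proof.
case: u v => [a d] [b e]; apply: injective_projections => /=; last first.
  by rewrite [LHS]mulrCA.
by rewrite !scalerDr cscalerAr !scalerA (mulrC d c).
Qed.

HB.instance Definition _ :=
  GRing.Lalgebra_isAlgebra.Build R[i] (unitization A) uscalerAr.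

End Unitization.

(** * Involution and operator bounds on the unitization *)

Section Bounds.
Context {R : realType} {A : cstarAlgType R}.
Local Notation U := (unitization A).
Implicit Types (a x : A) (u v : U) (c : R[i]) (k : R).

Definition emb a : U := (a, 0).

Lemma emb_inj : injective emb.
Proof. by move=> a b []. Qed.

Lemma embE u : u.2 = 0 -> u = emb u.1.
Proof. by case: u => a c /= ->. Qed.

Lemma emb_is_linear : linear emb.
Proof. by move=> c a b; congr pair; rewrite /= addr0 [c *: 0]mulr0. Qed.

HB.instance Definition _ := GRing.isLinear.Build R[i] A U *:%R emb emb_is_linear.

Lemma embD a b : emb (a + b) = emb a + emb b.
Proof. exact: raddfD. Qed.

Lemma embN a : emb (- a) = - emb a.
Proof. exact: raddfN. Qed.

Lemma embB a b : emb (a - b) = emb a - emb b.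
Proof. exact: raddfB. Qed.

Lemma embZ c a : emb (c *: a) = c *: emb a.
Proof. exact: linearZ. Qed.

Lemma emb0 : emb 0 = 0.
Proof. by []. Qed.

Lemma emb_cmul a b : emb (cmul a b) = emb a * emb b.
Proof.
apply: injective_projections => /=; last by rewrite mulr0.
by rewrite !scale0r !addr0.
Qed.

Lemma umul2 u v : (u * v).2 = u.2 * v.2.
Proof. by []. Qed.

Definition ustar u : U := (star u.1, Num.conj u.2).

Lemma ustarK u : ustar (ustar u) = u.
Proof. by case: u => a c; rewrite /ustar /= starK conjCK. Qed.

Lemma ustarD u v : ustar (u + v) = ustar u + ustar v.
Proof. by apply: injective_projections; rewrite /= ?starD ?rmorphD. Qed.

Lemma ustarZ c u : ustar (c *: u) = Num.conj c *: ustar u.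
Proof. by apply: injective_projections; rewrite /= ?starZ // [LHS]rmorphM. Qed.

Lemma ustarN u : ustar (- u) = - ustar u.
Proof. by rewrite -scaleN1r ustarZ rmorphN1 scaleN1r. Qed.

Lemma ustarB u v : ustar (u - v) = ustar u - ustar v.
Proof. by rewrite ustarD ustarN. Qed.

Lemma star0 : star (0 : A) = 0.
Proof. by rewrite -[X in star X](scale0r (0 : A)) starZ rmorph0 scale0r. Qed.

Lemma starN a : star (- a) = - star a.
Proof. by rewrite -scaleN1r starZ rmorphN1 scaleN1r. Qed.

Lemma ustar1 : ustar 1 = 1.
Proof. by rewrite /ustar /= star0 rmorph1. Qed.

Lemma ustarM u v : ustar (u * v) = ustar v * ustar u.
Proof.
apply: injective_projections; rewrite /= ?[LHS]rmorphM 1?mulrC //.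
by rewrite !starD !starZ starM addrAC.
Qed.

Lemma ustarX u n : ustar (u ^+ n) = ustar u ^+ n.
Proof. by elim: n => [|n IH]; rewrite ?ustar1 // exprS ustarM IH -exprSr. Qed.

Lemma ustar_emb a : ustar (emb a) = emb (star a).
Proof. by rewrite /ustar /= rmorph0. Qed.

Lemma conjR (r : R) : Num.conj r%:C = r%:C.
Proof. by apply: CrealP; rewrite realE !lecE /= eqxx le_total. Qed.

(** [A] is an ideal of its unitization, so left multiplication by [u] restricts to it. *)
Definition act u x : A := (u * emb x).1.

Lemma actE u x : act u x = cmul u.1 x + u.2 *: x.
Proof. by rewrite /act /= scale0r addr0. Qed.

Lemma emb_act u x : emb (act u x) = u * emb x.
Proof. by rewrite -embE //= mulr0. Qed.

Lemma actM u v x : act (u * v) x = act u (act v x).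
Proof. by apply: emb_inj; rewrite !emb_act mulrA. Qed.

Lemma actD u v x : act (u + v) x = act u x + act v x.
Proof. by apply: emb_inj; rewrite embD !emb_act mulrDl. Qed.

Lemma actN u x : act (- u) x = - act u x.
Proof. by apply: emb_inj; rewrite embN !emb_act mulNr. Qed.

Lemma actZ c u x : act (c *: u) x = c *: act u x.
Proof. by apply: emb_inj; rewrite embZ !emb_act scalerAl. Qed.

Lemma act1 x : act 1 x = x.
Proof. by apply: emb_inj; rewrite emb_act mul1r. Qed.

Lemma act_emb a x : act (emb a) x = cmul a x.
Proof. by apply: emb_inj; rewrite emb_act emb_cmul. Qed.

(* The operator norm of [u] on [A] and its scalar part are at most [k]. The
   scalar part is included because the action on [A] need not be faithful when
   [A] has a unit. *)
Definition bnd u k : Prop :=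
  rnorm u.2 <= k /\ forall x, rnorm (act u x) <= k * rnorm x.

Lemma bnd_ge0 u k : bnd u k -> 0 <= k.
Proof. by move=> [h _]; apply: le_trans h; apply: rnorm_ge0. Qed.

Lemma bnd_le u k l : k <= l -> bnd u k -> bnd u l.
Proof.
move=> kl [h1 h2]; split=> [|x]; first exact: le_trans kl.
by apply: le_trans (h2 x) _; rewrite ler_wpM2r ?rnorm_ge0.
Qed.

Lemma bndD u v k l : bnd u k -> bnd v l -> bnd (u + v) (k + l).
Proof.
move=> [h1 h2] [g1 g2]; split=> [|x].
  by apply: le_trans (rnormD _ _) _; apply: lerD.
rewrite actD; apply: le_trans (rnormD _ _) _; rewrite mulrDl.
exact: lerD.
Qed.

Lemma bndM u v k l : bnd u k -> bnd v l -> bnd (u * v) (k * l).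
Proof.
move=> hu hv; have k0 := bnd_ge0 hu; move: hu hv => [h1 h2] [g1 g2].
split=> [|x]; first by rewrite umul2 rnormM ler_pM // rnorm_ge0.
by rewrite actM; apply: le_trans (h2 _) _; rewrite -mulrA ler_wpM2l.
Qed.

Lemma bndZ c u k : bnd u k -> bnd (c *: u) (rnorm c * k).
Proof.
move=> [h1 h2]; split=> [|x]; first by rewrite rnormM ler_wpM2l ?rnorm_ge0.
by rewrite actZ rnormZ -mulrA ler_wpM2l ?rnorm_ge0.
Qed.

Lemma bndZR (r : R) u k : 0 <= r -> bnd u k -> bnd (r%:C *: u) (r * k).
Proof. by move=> r0 /(bndZ r%:C); rewrite rnormR ger0_norm. Qed.

Lemma bndN u k : bnd u k -> bnd (- u) k.
Proof. by move=> [h1 h2]; split=> [|x]; rewrite ?actN rnormN. Qed.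

Lemma bndB u v k l : bnd u k -> bnd v l -> bnd (u - v) (k + l).
Proof. by move=> hu hv; apply: bndD => //; apply: bndN. Qed.

Lemma bnd1 : bnd 1 1.
Proof. by split=> [|x]; rewrite ?act1 ?mul1r // rnorm1. Qed.

Lemma bnd_alg c : bnd c%:A (rnorm c).
Proof. by rewrite -[rnorm c]mulr1; apply/bndZ/bnd1. Qed.

Lemma bnd_emb a : bnd (emb a) (rnorm a).
Proof.
split=> [|x]; first by rewrite /= rnorm0 rnorm_ge0.
by rewrite act_emb rnorm_cmul.
Qed.

Lemma bnd_ex u : exists2 k, 0 <= k & bnd u k.
Proof.
have : bnd (emb u.1 + u.2%:A) (rnorm u.1 + rnorm u.2).
  by apply: bndD; [apply: bnd_emb | apply: bnd_alg].
have -> : emb u.1 + u.2%:A = u.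
  by apply: injective_projections; rewrite /= ?scaler0 ?addr0 // add0r [LHS]mulr1.
by move=> h; exists (rnorm u.1 + rnorm u.2) => //; apply: bnd_ge0 h.
Qed.

(** Testing at [x = star a] gives [|a|^2 <= k |a|]. *)
Lemma rnorm_le_act a k : (forall x, rnorm (cmul a x) <= k * rnorm x) -> 0 <= k ->
  rnorm a <= k.
Proof.
move=> h k0; have := h (star a).
rewrite -{1}[a]starK rnorm_cstar rnorm_star expr2.
have := rnorm_ge0 a; rewrite le_eqVlt => /predU1P[<- //|a0].
by rewrite ler_pM2r.
Qed.

Lemma rnorm_le_bnd a k : bnd (emb a) k -> rnorm a <= k.
Proof.
move=> h; apply: rnorm_le_act (bnd_ge0 h) => x.
by rewrite -act_emb; case: h.
Qed.

Lemma rnorm_act_sqr u x :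
  rnorm (act u x) ^+ 2 = rnorm (cmul (star x) (act (ustar u * u) x)).
Proof.
rewrite -rnorm_cstar; congr rnorm; apply: emb_inj.
by rewrite !emb_cmul -ustar_emb !emb_act ustarM ustar_emb !mulrA.
Qed.

(** The C*-identity carried over to operator bounds: [|u x|^2] is the norm of [star x] times
    [ustar u * u] acting on [x]. *)
Lemma bnd_cstar u k : 0 <= k -> bnd (ustar u * u) (k ^+ 2) -> bnd u k.
Proof.
move=> k0 [h1 h2]; split=> [|x].
  by move: h1; rewrite umul2 rnormM rnorm_conj -expr2 ler_sqr ?nnegrE ?rnorm_ge0.
rewrite -ler_sqr ?nnegrE ?rnorm_ge0 ?mulr_ge0 ?rnorm_ge0 //.
rewrite rnorm_act_sqr exprMn; apply: le_trans (rnorm_cmul _ _) _.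
rewrite rnorm_star; apply: le_trans (ler_wpM2l (rnorm_ge0 _) (h2 x)) _.
by rewrite mulrCA -expr2.
Qed.

Lemma bnd_star u k : bnd u k -> bnd (ustar u) k.
Proof.
move=> hu; have k0 := bnd_ge0 hu; case: (hu) => [h1 h2].
split=> [|x]; first by rewrite rnorm_conj.
set y := act (ustar u) x.
have : rnorm y ^+ 2 <= k * rnorm x * rnorm y.
  rewrite rnorm_act_sqr actM ustarK; apply: le_trans (rnorm_cmul _ _) _.
  by rewrite rnorm_star [leRHS]mulrAC [leRHS]mulrC ler_wpM2l ?rnorm_ge0.
have := rnorm_ge0 y; rewrite le_eqVlt => /predU1P[<- _|y0].
  by rewrite mulr_ge0 ?rnorm_ge0.
by rewrite expr2 ler_pM2r.
Qed.

Lemma bnd_eq0 u : (forall e, 0 < e -> bnd u e) -> u = 0.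
Proof.
move=> h.
have u2 : u.2 = 0.
  apply: rnorm_le0; apply/ler_addgt0Pr => e e0; rewrite add0r; exact: (h e e0).1.
rewrite (embE u2) (_ : u.1 = 0) ?emb0 //.
apply: rnorm_le0; apply/ler_addgt0Pr => e e0; rewrite add0r.
by apply: rnorm_le_bnd; rewrite -embE //; apply: h.
Qed.

End Bounds.

(** * Completeness of the unitization *)

Section Completeness.
Context {R : realType} {A : cstarAlgType R}.
Local Notation U := (unitization A).
Local Open Scope classical_set_scope.

Lemma cstar_complete (a : nat -> A) :
  (forall e : R, 0 < e ->
     exists N, forall l m, (N <= l)%N -> (N <= m)%N -> rnorm (a l - a m) <= e) ->
  exists x, forall e : R, 0 < e ->
     exists N, forall l, (N <= l)%N -> rnorm (x - a l) <= e.
Proof.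
move=> Ha.
have half_re (e : R[i]) : 0 < e -> 0 < complex.Re e / 2 /\ ((complex.Re e / 2)%:C < e).
  rewrite !ltcE /= => /andP[/eqP -> e0]; rewrite eqxx /=; split; lra.
have : cauchy (a @ \oo).
  apply/cauchy_ballP => e /half_re[e0 lt_e]; have [N HN] := Ha _ e0.
  near_simpl; exists ([set n | N <= n]%N, [set n | N <= n]%N).
    by split; exists N.
  move=> [l m] [/= hl hm]; rewrite -ball_normE /=; apply: le_lt_trans lt_e.
  by rewrite rnormE lecR; apply: HN.
move=> /cauchy_cvg/cvg_ex[x /cvgrPdist_le cx]; exists x => e e0.
have e0' : 0 < e%:C by rewrite ltcR.
have [N _ HN] := cx _ e0'; exists N => l hl.
by rewrite -lecR -rnormE; apply: HN.
Qed.
End Completeness.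

Section UComplete.
Context {R : realType} {A : cstarAlgType R}.
Local Notation U := (unitization A).

(* The limit [c] of the scalar parts is supplied by the caller, who knows it:
   completeness is only assumed for [A]. *)
Lemma bnd_complete (z : nat -> U) (e : nat -> R) (c : R[i]) :
  (forall d, 0 < d -> exists N, forall l, (N <= l)%N -> e l < d) ->
  (forall k l, (k <= l)%N -> bnd (z l - z k) (e k)) ->
  (forall k, rnorm (c - (z k).2) <= e k) ->
  exists2 w : U, w.2 = c & forall k, bnd (w - z k) (e k).
Proof.
move=> e0 zB cB.
(* Multiplication by the difference of the [A]-parts is the action of [z m - z l] minus its scalar
   part; each is bounded by [e l], hence the factor 2. *)
have near_z l m : (l <= m)%N -> rnorm ((z m).1 - (z l).1) <= 2 * e l.
  move=> lm; have [h1 h2] := zB _ _ lm; have el := bnd_ge0 (zB _ _ lm).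
  apply: rnorm_le_act => [x|]; last by rewrite mulr_ge0.
  rewrite (_ : cmul _ x = act (z m - z l) x - (z m - z l).2 *: x); last first.
    by rewrite actE addrK.
  apply: le_trans (rnormD _ _) _; rewrite rnormN rnormZ.
  have := h2 x; have := ler_wpM2r (rnorm_ge0 x) h1; lra.
have [e' e'0|a Ha] := @cstar_complete R A (fun k => (z k).1).
  have [|N HN] := e0 (e' / 4); first lra.
  exists N => l m hl hm; have eN := HN _ (leqnn N).
  rewrite -(subrK (z N).1 (z l).1) -addrA -(opprB (z m).1).
  apply: le_trans (rnormD _ _) _; rewrite rnormN.
  have := near_z _ _ hl; have := near_z _ _ hm; lra.
exists (a, c) => // k; split=> [|x]; first exact: cB.
apply/ler_addgt0Pr => d d0.
have nx := rnorm_ge0 x; have nx1 : 0 < rnorm x + 1 by lra.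
(* The added 1 keeps the denominator positive at [x = 0]; each of the two error terms is then at
   most [d / 2]. *)
pose d' := d / 2 / (rnorm x + 1).
have d'0 : 0 < d' by rewrite /d' divr_gt0 // divr_gt0.
have [N1 HN1] := Ha _ d'0; have [N2 HN2] := e0 _ d'0.
pose l := (k + N1 + N2)%N.
have al := HN1 l ltac:(by rewrite /l addnAC leq_addl).
have el := HN2 l (leq_addl _ _).
have [_ zkl] := zB k l ltac:(by rewrite /l -addnA leq_addr).
rewrite (_ : _ - z k = ((a, c) - z l) + (z l - z k)); last by rewrite addrA subrK.
rewrite actD; apply: le_trans (rnormD _ _) _.
rewrite addrC; apply: lerD; first exact: zkl.
rewrite actE /=.
apply: le_trans (rnormD _ _) _; rewrite rnormZ.
have h1 : rnorm (cmul (a - (z l).1) x) <= d' * rnorm x.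
  by apply: le_trans (rnorm_cmul _ _) _; rewrite ler_wpM2r.
have h2 : rnorm (c - (z l).2) * rnorm x <= d' * rnorm x.
  by rewrite ler_wpM2r // (le_trans (cB l)) // ltW.
have h3 : d' * (rnorm x + 1) = d / 2 by rewrite /d' divfK // gt_eqF.
have : d' * rnorm x <= d / 2 by rewrite -h3 ler_wpM2l ?ltW // ltrDl.
lra.
Qed.

End UComplete.

(** * Square roots by the binomial series *)

Section Zeta.
Context {R : realType}.

(** The iteration of [sqrt_1sub] at the scalar [x = 1]; its increments majorize those for any [x] of
    bound 1. *)
Definition zeta (k : nat) : R := iter k (fun t => 2^-1 * (1 + t ^+ 2)) 0.

Lemma zetaS k : zeta k.+1 = 2^-1 * (1 + zeta k ^+ 2).
Proof. by []. Qed.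

Lemma zeta_bounds k : 0 <= zeta k <= 1.
Proof.
elim: k => [|k]; first by rewrite /= lexx ler01.
by rewrite zetaS; set t := zeta k; nra.
Qed.

(* With d = 1 - zeta k the recursion reads d' = d - d ^ 2 / 2, which keeps
   d <= 2 / (k + 2). *)
Lemma zeta_rate k : 1 - zeta k <= 2 / k.+2%:R.
Proof.
elim: k => [|k]; first by rewrite /= subr0 divff ?pnatr_eq0.
have := zeta_bounds k; rewrite zetaS -[k.+3]addn1 natrD.
have n2 : (2 : R) <= k.+2%:R by rewrite ler_nat.
set n : R := k.+2%:R in n2 *; set t := zeta k => /andP[t0 t1].
have n0 : 0 < n by lra.
have n1 : 0 < n + 1 by lra.
move=> IH; rewrite ler_pdivlMr //.
set s := 2 / n in IH *; have sn : s * n = 2 by rewrite /s divfK // gt_eqF.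
have s1 : s <= 1 by rewrite ler_pdivrMr // mul1r.
have s0 : 0 < s by rewrite divr_gt0.
have h1 : 1 - 2^-1 * (1 + t ^+ 2) <= s - s ^+ 2 / 2 by nra.
have h2 : (s - s ^+ 2 / 2) * (n + 1) = 2 - s ^+ 2 / 2.
  have : s ^+ 2 * n = s * 2 by rewrite expr2 -mulrA sn.
  lra.
apply: (@le_trans _ _ ((s - s ^+ 2 / 2) * (n + 1))); last first.
  by have := sqr_ge0 s; rewrite h2; lra.
by rewrite ler_wpM2r //; lra.
Qed.

Lemma zeta_to1 (d : R) : 0 < d ->
  exists N, forall l, (N <= l)%N -> 1 - zeta l < d.
Proof.
move=> d0; exists (Num.bound (2 / d)) => l hl.
apply: le_lt_trans (zeta_rate l) _; rewrite ltr_pdivrMr ?ltr0n // mulrC.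
rewrite -ltr_pdivrMr //; apply: lt_le_trans (archi_boundP _) _.
  by rewrite divr_ge0 // ltW.
by rewrite ler_nat (leq_trans hl) // leqW.
Qed.
End Zeta.

Section Limits.
Context {R : realType} {A : cstarAlgType R}.
Local Notation U := (unitization A).
Variable e : nat -> R.
Hypothesis e0 : forall d : R, 0 < d -> exists N, forall l, (N <= l)%N -> e l < d.

Lemma bnd_eq0_seq (u : U) (C : R) : 0 <= C -> (forall k, bnd u (C * e k)) -> u = 0.
Proof.
move=> C0 h; apply: bnd_eq0 => d d0.
have C1 : 0 < C + 1 by lra.
have [N HN] := e0 (divr_gt0 d0 C1).
apply: bnd_le (h N); have := ltW (HN _ (leqnn N)).
rewrite ler_pdivlMr // => eN; have := ler_wpM2l C0 (ltW (HN _ (leqnn N))).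
move=> /le_trans; apply; rewrite mulrA ler_pdivrMr // mulrC.
by rewrite ler_wpM2l ?ltW // ltrDl.
Qed.

Lemma comm_lim (w y : U) (z : nat -> U) :
  (forall k, bnd (w - z k) (e k)) -> (forall k, GRing.comm y (z k)) ->
  GRing.comm y w.
Proof.
move=> wz yz; have [K K0 yK] := bnd_ex y.
apply/eqP; rewrite -subr_eq0; apply/eqP.
apply: (@bnd_eq0_seq _ (K + K)) => [|k]; first by rewrite addr_ge0.
have -> : y * w - w * y = y * (w - z k) - (w - z k) * y.
  by rewrite mulrBr mulrBl yz opprB addrA subrK.
by rewrite [X in bnd _ X]mulrDl; apply: bndB; [|rewrite mulrC]; apply: bndM.
Qed.
End Limits.

(** * Neumann series *)

Section Neumann.
Context {R : realType} {A : cstarAlgType R}.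
Local Notation U := (unitization A).

Lemma geometric_to0 (M r : R) : 0 <= r < 1 -> 0 <= M -> forall d : R, 0 < d ->
  exists N, forall l, (N <= l)%N -> M * r ^+ l < d.
Proof.
move=> /andP[r0 r1] M0 d d0; have M1 : 0 < M + 1 by lra.
have /cvg_expr/cvgr0Pnorm_lt/(_ (d / (M + 1))) : `|r| < 1 by rewrite ger0_norm.
case=> [|N _ HN]; first exact: divr_gt0.
exists N => l /HN; rewrite /= ger0_norm ?exprn_ge0 // ltr_pdivlMr //.
have := exprn_ge0 l r0; nra.
Qed.

Lemma comm_alg (y : U) (c : R[i]) : GRing.comm y c%:A.
Proof. by rewrite /GRing.comm mulr_algr mulr_algl. Qed.

Lemma neumann (u : U) (r : R) : bnd u r -> r < 1 -> uinvertible (1 - u).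
Proof.
move=> ur r1; have r0 := bnd_ge0 ur; have s0 : 0 < 1 - r by lra.
have c1 : 1 - u.2 != 0.
  apply/eqP => /subr0_eq c1; case: ur => + _; rewrite -c1 rnorm1; lra.
(* This starting scalar keeps the scalar part of every iterate equal to [(1 - u.2)^-1], so the
   scalar limit wanted by [bnd_complete] is known. *)
pose z k : U := iter k (fun t => 1 + u * t) (1 - u.2)^-1%:A.
have zS k : z k.+1 = 1 + u * z k by [].
have uz k : GRing.comm u (z k).
  elim: k => [|k IH]; first exact: comm_alg.
  by rewrite zS; apply: commrD; [apply: commr1 | apply: commrM].
have z2 k : (z k).2 = (1 - u.2)^-1.
  elim: k => [|k IH]; first exact: mulr1.
  by rewrite zS /= IH; apply: (mulfI c1); rewrite mulrDr mulrCA mulfV // !mulr1 subrK.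
have [M M0 dM] := bnd_ex (z 1%N - z 0%N).
have zd k : bnd (z k.+1 - z k) (M * r ^+ k).
  elim: k => [|k IH]; first by rewrite mulr1.
  rewrite !zS opprD addrACA subrr add0r -mulrBr exprS mulrCA.
  exact: bndM.
(* The tail of the geometric series formed by the bounds in [zd]. *)
pose e k := M / (1 - r) * r ^+ k.
have eS k : e k = M * r ^+ k + e k.+1.
  by rewrite /e exprS; field; rewrite gt_eqF.
have Ms : 0 <= M / (1 - r) by rewrite divr_ge0 // ltW.
have e_ge0 k : 0 <= e k by rewrite mulr_ge0 // exprn_ge0.
have e0 (d : R) : 0 < d -> exists N, forall l, (N <= l)%N -> e l < d.
  by move: d; apply: geometric_to0 => //; rewrite r0.
have zl k j : bnd (z (j + k)%N - z k) (e k).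
  elim: j k => [|j IH] k.
    by rewrite subrr -[0]/(emb 0); apply: bnd_le (bnd_emb 0); rewrite rnorm0.
  rewrite addSnnS -(subrK (z k.+1) (z _)) -addrA eS addrC.
  by apply: bndD => //; apply: IH.
have [||w w2 wz] := @bnd_complete R A z e (1 - u.2)^-1 e0.
- by move=> k l /subnK <-.
- by move=> k; rewrite z2 subrr rnorm0.
have uw : GRing.comm u w by apply: comm_lim wz uz.
suff uw1 : (1 - u) * w = 1.
  have wu1 : w * (1 - u) = 1 by rewrite -[RHS]uw1 mulrBr mulrBl mulr1 mul1r uw.
  by exists w.
apply/eqP; rewrite -subr_eq0; apply/eqP; apply: (bnd_eq0_seq e0 (C := 2 + r)).
  by rewrite addr_ge0.
move=> k.
have -> : (1 - u) * w - 1 = (w - z k) - u * (w - z k) + (z k - z k.+1).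
    rewrite zS mulrBl mul1r mulrBr opprB (opprD 1) addrACA subrK -addrA.
  by congr (w + _); rewrite [- 1 - _]addrC addrACA subrr add0r.
rewrite -[z k - _]opprB (_ : (2 + r) * e k = (e k + r * e k) + e k); last by ring.
apply: bndB; first by apply: bndB => //; apply: bndM.
exact: (zl k 1%N).
Qed.
End Neumann.

Lemma subr_sqr_comm (S : pzRingType) (a b : S) : GRing.comm a b ->
  a ^+ 2 - b ^+ 2 = (a - b) * (a + b).
Proof.
by move=> ab; rewrite mulrBl !mulrDr -!expr2 ab opprD addrA addrK.
Qed.

Lemma commrZ (S : pzRingType) (V : algType S) (a b : V) (c : S) :
  GRing.comm a b -> GRing.comm a (c *: b).
Proof. by move=> ab; rewrite /GRing.comm -scalerAr ab scalerAl. Qed.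

Section SquareRoot.
Context {R : realType} {A : cstarAlgType R}.
Local Notation U := (unitization A).

(* 1 - z is the square root of 1 - x given by the binomial series: z is the
   limit of z' = (x + z ^ 2) / 2, whose increments are polynomials in x with
   nonnegative coefficients and so are bounded by their value at x = 1. *)
Lemma sqrt_1sub (x : U) : bnd x 1 -> x.2 = 0 \/ x.2 = 1 ->
  exists z : U, [/\ bnd z 1, z.2 = x.2, (1 - z) ^+ 2 = 1 - x,
    ustar x = x -> ustar z = z & forall y, GRing.comm y x -> GRing.comm y z].
Proof.
move=> x1 x2; pose h : R[i] := (2^-1 : R)%:C.
pose z k : U := iter k (fun t => h *: (x + t ^+ 2)) 0.
have zS k : z k.+1 = h *: (x + z k ^+ 2) by [].
have h0 : (0 : R) <= 2^-1 by rewrite invr_ge0.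
have hh : h + h = 1.
  by rewrite /h -rmorphD /= (_ : 2^-1 + 2^-1 = 1) //; field.
have zb k : bnd (z k) (zeta k).
  elim: k => [|k IH].
    by rewrite -[z 0]/(emb 0) -[zeta 0](@rnorm0 _ A); apply: bnd_emb.
  by rewrite zS zetaS; apply/bndZR/bndD => //; rewrite !expr2; apply: bndM.
have zc k y : GRing.comm y x -> GRing.comm y (z k).
  move=> yx; elim: k => [|k IH]; first exact: commr0.
  by rewrite zS; apply/commrZ/commrD => //; apply: commrX.
have zz k : GRing.comm (z k) x by apply/commr_sym/zc.
have dz k : bnd (z k.+1 - z k) (zeta k.+1 - zeta k).
  elim: k => [|k IH]; first by rewrite !subr0; apply: zb.
  have -> : z k.+2 - z k.+1 = h *: ((z k.+1 - z k) * (z k.+1 + z k)).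
    rewrite -subr_sqr_comm; last exact/zc/zz.
    rewrite -[LHS]/(h *: (x + z k.+1 ^+ 2) - h *: (x + z k ^+ 2)).
    by rewrite -scalerBr opprD addrACA subrr add0r.
  have -> : zeta k.+2 - zeta k.+1 =
      2^-1 * ((zeta k.+1 - zeta k) * (zeta k.+1 + zeta k)) :> R.
    by rewrite (zetaS k.+1) [in X in _ - X](zetaS k) -subr_sqr; ring.
  by apply: bndZR => //; apply: bndM => //; apply: bndD.
have zl k j : bnd (z (j + k)%N - z k) (zeta (j + k) - zeta k).
  elim: j => [|j IH].
    by rewrite !subrr -[0]/(emb 0) -[X in bnd _ X](@rnorm0 _ A); apply: bnd_emb.
  rewrite addSn -(subrK (z (j + k)%N) (z _)) -addrA.
  rewrite -(subrK (zeta (j + k)) (zeta _.+1)) -[X in bnd _ X]addrA.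
  exact: bndD.
have [||w w2 wz] := @bnd_complete R A z (fun k => 1 - zeta k) x.2 zeta_to1.
- move=> k l /subnK <-; apply: bnd_le (zl _ _).
  by have /andP[_ ] := @zeta_bounds R (l - k + k); lra.
(* For the two allowed scalar parts the iterates are explicit: constantly 0, or [zeta k] with limit
   1. *)
- move=> k; have /andP[t0 t1] := @zeta_bounds R k.
  case: x2 => x2; rewrite x2.
    have -> : (z k).2 = 0.
      by elim: k {t0 t1} => [//|k IH]; rewrite zS /= x2 add0r IH mulr0 [LHS]mulr0.
    by rewrite subrr rnorm0; lra.
  have -> : (z k).2 = (zeta k)%:C.
    elim: k {t0 t1} => [//|k IH]; rewrite zS zetaS /= x2 IH.
    by rewrite -[LHS]/(h * _) rmorphM rmorphD rmorphXn.
  by rewrite -[1 : R[i]]/(1%:C) -rmorphB rnormR ger0_norm //; lra.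
have w1 : bnd w 1.
  by rewrite -(subrK (z 0%N) w) -(subrK (zeta 0) 1); apply: bndD.
have wc y : GRing.comm y x -> GRing.comm y w.
  by move=> yx; apply: (comm_lim (@zeta_to1 R) wz) => k; apply: zc.
have wE : w = h *: (x + w ^+ 2).
  apply/eqP; rewrite -subr_eq0; apply/eqP.
  apply: (bnd_eq0_seq (@zeta_to1 R) (C := 2)) => // k.
  have -> : w - h *: (x + w ^+ 2) = (w - z k.+1) - h *: (w ^+ 2 - z k ^+ 2).
    by rewrite zS -addrA -opprD -scalerDr addrACA subrr addr0.
  have /andP[t0 t1] := @zeta_bounds R k.
  apply: (@bnd_le _ _ _ ((1 - zeta k.+1) + 2^-1 * ((1 - zeta k) * (1 + zeta k)))).
    by rewrite zetaS; nra.
  apply: bndB => //; apply: bndZR => //.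
  by rewrite subr_sqr_comm; [apply: bndM => //; apply: bndD | apply/zc/commr_sym/wc].
exists w; split=> //.
- have w_2 : w *+ 2 = x + w ^+ 2.
    by rewrite mulr2n {1 2}wE -scalerDl hh scale1r.
  by rewrite -sqrrN opprB sqrrB1 w_2 opprD addrCA subrr addr0 addrC.
- move=> sx.
  have sz k : ustar (z k) = z k.
    elim: k => [|k IH]; first by rewrite -[z 0]/(emb 0) ustar_emb star0.
    by rewrite zS ustarZ conjR ustarD sx ustarX IH.
  apply/eqP; rewrite -subr_eq0; apply/eqP.
  apply: (bnd_eq0_seq (@zeta_to1 R) (C := 2)) => // k.
  have -> : ustar w - w = ustar (w - z k) - (w - z k).
    by rewrite ustarB sz opprB addrA subrK.
  by rewrite mulr_natl mulr2n; apply: bndB => //; apply: bnd_star.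
Qed.

(** For [u = x + i y] commutation gives [ustar u * u = x^2 + y^2], so [u] and [ustar u] are bounded
    by [k], and [x] is their mean. *)
Lemma sum_sqr_bnd (x y : U) (k : R) : 0 <= k -> ustar x = x -> ustar y = y ->
  GRing.comm x y -> bnd (x ^+ 2 + y ^+ 2) (k ^+ 2) -> bnd x k.
Proof.
move=> k0 sx sy xy b; pose u := x + 'i *: y.
have su : ustar u = x - 'i *: y by rewrite ustarD ustarZ sx sy conjCi scaleNr.
have uu : ustar u * u = x ^+ 2 + y ^+ 2.
  rewrite su -subr_sqr_comm; last exact: commrZ.
  by rewrite exprZn sqrCi scaleN1r opprK.
have bu : bnd u k by apply: bnd_cstar => //; rewrite uu.
have -> : x = (2^-1 : R)%:C *: (u + ustar u).
  rewrite su addrACA subrr addr0 -mulr2n -[x *+ 2]scaler_nat scalerA.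
  by rewrite fmorphV rmorph_nat mulVf ?scale1r // pnatr_eq0.
rewrite (_ : k = 2^-1 * (k + k)); last by field.
by apply: bndZR; rewrite ?invr_ge0 //; apply: bndD => //; apply: bnd_star.
Qed.

End SquareRoot.

(** * Invertibility and the spectrum *)

Section Invertible.
Context {R : realType} {A : cstarAlgType R}.
Local Notation U := (unitization A).
Implicit Types u v : U.

Lemma uinvertibleP u :
  uinvertible u <-> exists v, u * v = 1 /\ v * u = 1.
Proof. by []. Qed.

Lemma uinvertibleM u v : uinvertible u -> uinvertible v -> uinvertible (u * v).
Proof.
move=> [u' [uu' u'u]] [v' [vv' v'v]]; apply/uinvertibleP; exists (v' * u').
split.
  by rewrite -mulrA [v * _]mulrA [v * v']vv' mul1r.
by rewrite -mulrA [u' * _]mulrA [u' * u]u'u mul1r.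
Qed.

Lemma uinvertibleZ (c : R[i]) u : c != 0 -> uinvertible u -> uinvertible (c *: u).
Proof.
move=> c0 [u' [uu' u'u]]; apply/uinvertibleP; exists (c^-1 *: u').
by rewrite -!scalerAl -!scalerAr !scalerA mulfV // mulVf // !scale1r.
Qed.

(** If [w] inverts [u v = v u], then [v w] is a right and [w v] a left inverse of [u], so the two
    agree. *)
Lemma uinvertibleMl u v :
  GRing.comm u v -> uinvertible (u * v) -> uinvertible u.
Proof.
move=> uv [w [uvw wuv]]; apply/uinvertibleP; exists (v * w).
have h1 : u * (v * w) = 1 by rewrite mulrA.
have h2 : w * v * u = 1 by rewrite -mulrA -uv.
have vw : v * w = w * v by rewrite -[LHS]mul1r -[X in X * _]h2 -(mulrA (w * v)) h1 mulr1.
by split=> //; rewrite vw.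
Qed.

Lemma spectrumE (a : A) (c : R[i]) :
  spectrum a c <-> ~ uinvertible (c%:A - emb a).
Proof.
rewrite /spectrum /=.
suff -> : ((- a, c) : U) = c%:A - emb a by [].
apply: injective_projections; rewrite /= ?scaler0 ?add0r //.
by rewrite subr0 [RHS]mulr1.
Qed.

Lemma not_spectrum (a : A) (c : R[i]) :
  cpositive a -> ~~ (0 <= c) -> uinvertible (c%:A - emb a).
Proof.
by move=> [_ pa] c0; apply: contrapT => /spectrumE/pa; apply/negP.
Qed.

(** Factoring out [l - m] leaves 1 minus an element of bound [r / |l - m| < 1], to which the Neumann
    series applies. *)
Lemma disk_invertible (u : U) (m l : R[i]) (r : R) :
  bnd (m%:A - u) r -> r < rnorm (l - m) -> uinvertible (l%:A - u).
Proof.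
move=> b lt_r; have r0 := bnd_ge0 b.
have n0 : 0 < rnorm (l - m) by apply: le_lt_trans lt_r.
have lm : l - m != 0 by apply: contraTneq n0 => ->; rewrite rnorm0 ltxx.
have -> : l%:A - u = (l - m) *: (1 - (- (l - m)^-1) *: (m%:A - u)).
  rewrite scalerBr scaleNr scalerN opprK scalerA mulfV // scale1r.
  by rewrite scalerBl addrA subrK.
apply: uinvertibleZ => //; apply: (@neumann _ _ _ ((rnorm (l - m))^-1 * r)).
  by rewrite -rnormV -rnormN; apply: bndZ.
by rewrite mulrC ltr_pdivrMr // mul1r.
Qed.

(* On the spectrum of [p], [x] can only take the values [0] and [p]. *)
Lemma sqr_eq_mul_invertible (x p : U) (l : R[i]) :
  GRing.comm x p -> x ^+ 2 = p * x -> l != 0 ->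
  uinvertible (l%:A - p) -> uinvertible (l%:A - x).
Proof.
move=> xp x2 l0 inv.
have lx : GRing.comm x l%:A by exact: comm_alg.
have lp : GRing.comm p l%:A by exact: comm_alg.
(* Since [x^2 = p x = x p], the product [(l - x) (l + x - p)] equals [l (l - p)]. *)
apply: (@uinvertibleMl _ (l%:A + (x - p))).
  apply: commrD; first exact: comm_alg.
  apply: commrB; apply/commr_sym/commrB => //; exact/commr_sym.
rewrite mulrDr mulrBl (mulrBl (x - p)) [x * (x - p)]mulrBr -expr2 x2 xp subrr subr0.
rewrite mulrBr addrA -lx subrK -mulrBr mulr_algl.
exact: uinvertibleZ.
Qed.

End Invertible.

(** * Positive elements *)

Section Positive.
Context {R : realType} {A : cstarAlgType R}.
Local Notation U := (unitization A).
Implicit Types (q c h x : A).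

Lemma Re_lt0 (l : R[i]) : ~~ (0 <= l) -> complex.Im l = 0 -> complex.Re l < 0.
Proof. by move=> l0 im0; move: l0; rewrite lecE /= im0 eqxx ltNge. Qed.

Lemma bnd_real_alg (r : R) : 0 <= r -> bnd (r%:C%:A : U) r.
Proof. by move=> r0; have := @bnd_alg R A r%:C; rewrite rnormR ger0_norm. Qed.

Lemma ustar_alg (l : R[i]) : ustar (l%:A : U) = (Num.conj l)%:A.
Proof. by rewrite ustarZ ustar1. Qed.

(* Norm form of positivity: the spectrum of q is real and lies in [0, 2t]. *)
Definition norm_positive q :=
  star q = q /\ exists2 t : R, 0 < t & bnd (t%:C%:A - emb q) t.

(** Here [(i t - q)] times its adjoint is [q^2 + t^2]. The resulting discs centred on the imaginary
    axis exclude non-real spectrum. *)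
Lemma sa_shift_bnd q (t : R) : star q = q ->
  bnd (('i * t%:C)%:A - emb q) (Num.sqrt (rnorm q ^+ 2 + t ^+ 2)).
Proof.
move=> sq; apply: bnd_cstar; first exact: sqrtr_ge0.
rewrite sqr_sqrtr ?addr_ge0 ?sqr_ge0 //.
have -> : ustar (('i * t%:C)%:A - emb q) * (('i * t%:C)%:A - emb q) =
          emb q ^+ 2 + (t ^+ 2)%:C%:A.
  rewrite ustarB ustar_alg ustar_emb sq rmorphM /= conjCi conjR mulNr scaleNr.
  set m := ('i * t%:C)%:A.
  rewrite (_ : m - _ = - (- m + emb q)); last by rewrite opprD opprK.
  rewrite mulrN -subr_sqr_comm; last exact/commr_sym/commrN/comm_alg.
  rewrite opprB sqrrN.
  congr (_ + _); rewrite /m exprZn expr1n exprMn sqrCi mulN1r scaleNr opprK.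
  by rewrite rmorphXn.
apply: bndD; first by rewrite !expr2; apply: bndM; apply: bnd_emb.
by apply: bnd_real_alg; apply: sqr_ge0.
Qed.

Lemma norm_positive_cpositive q : norm_positive q -> cpositive q.
Proof.
move=> [sq [t t0 qt]]; split=> // l /spectrumE; apply: contra_notT => l0.
have [im0|im0] := eqVneq (complex.Im l) 0.
  have re0 := Re_lt0 l0 im0; apply: disk_invertible qt _.
  rewrite -ltr_sqr ?nnegrE ?rnorm_ge0 // ?ltW // rnorm_sqr.
  by case: l im0 re0 {l0} => x y /= -> x0; nra.
(* Chosen so that [|l - i s|^2 = |l|^2 + |q|^2 + 1 + s^2], which exceeds the squared radius
   [|q|^2 + s^2]. *)
pose s := - ((rnorm q ^+ 2 + 1) / (2 * complex.Im l)).
apply: disk_invertible (sa_shift_bnd s sq) _.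
rewrite -ltr_sqr ?nnegrE ?rnorm_ge0 ?sqrtr_ge0 // rnorm_sqr.
rewrite sqr_sqrtr ?addr_ge0 ?sqr_ge0 //.
have hs : 2 * s * complex.Im l = - (rnorm q ^+ 2 + 1) by rewrite /s; field.
clearbody s.
case: l im0 hs {l0} => x y /= im0 hs.
rewrite !(mulr0, mul0r, mul1r, mulr1, subr0, add0r, oppr0, addr0).
have := sqr_ge0 x; nra.
Qed.

Lemma norm_positiveD p q :
  norm_positive p -> norm_positive q -> norm_positive (p + q).
Proof.
move=> [sp [s s0 ps]] [sq [t t0 qt]]; split; first by rewrite starD sp sq.
exists (s + t); first exact: addr_gt0.
by rewrite embD rmorphD scalerDl opprD addrACA; apply: bndD.
Qed.

Lemma norm_positive0 : norm_positive (0 : A).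
Proof.
split; first exact: star0.
by exists 1 => //; rewrite emb0 subr0; apply: bnd_real_alg.
Qed.

(** For [x = 1 - q / t], of bound 1, [sqrt_1sub] gives [1 - z = sqrt(q / t)], and
    [p = sqrt(t) (1 - z)]. As [z] has scalar part 1, [p] lies in [A]; [sqrt(t) - p = sqrt(t) z]
    yields its norm positivity. *)
Lemma norm_positive_sqrt q : norm_positive q ->
  exists p : A, [/\ norm_positive p, cmul p p = q
    & forall u : U, GRing.comm u (emb q) -> GRing.comm u (emb p)].
Proof.
move=> [sq [t t0 qt]].
pose x : U := 1 - (t^-1)%:C *: emb q.
have xE : x = (t^-1)%:C *: (t%:C%:A - emb q).
  by rewrite scalerBr scalerA -rmorphM mulVf ?gt_eqF // scale1r.
have x1 : bnd x 1.
  by rewrite xE -(@mulVf _ t) ?gt_eqF //; apply: bndZR; rewrite ?invr_ge0 ?ltW.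
have x2 : x.2 = 1 by rewrite /x /= [_ *: 0]mulr0 subr0.
have [|z [z1 z2 zx sz zc]] := @sqrt_1sub R A x x1; first by right.
pose s := Num.sqrt t.
have s0 : 0 < s by rewrite sqrtr_gt0.
have ss : s * s = t by rewrite -expr2 sqr_sqrtr // ltW.
pose p : A := (s%:C *: (1 - z)).1.
have pE : emb p = s%:C *: (1 - z).
  by rewrite -embE // /= z2 x2 subrr; exact: mulr0.
have sx : ustar x = x by rewrite ustarB ustar1 ustarZ conjR ustar_emb sq.
have pc (u : U) : GRing.comm u (emb q) -> GRing.comm u (emb p).
  move=> uq; rewrite pE; apply/commrZ/commrB; first exact: commr1.
  by apply: zc; apply: commrB; [exact: commr1 | apply: commrZ].
exists p; split=> //.
  split; first by apply: emb_inj; rewrite -ustar_emb pE ustarZ conjR ustarB ustar1 sz.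
  exists s => //; rewrite pE -scalerBr opprB addrCA subrr addr0.
  by rewrite -{2}[s]mulr1; apply: bndZR => //; apply: ltW.
apply: emb_inj; rewrite emb_cmul pE -scalerAl -scalerAr scalerA -rmorphM ss -expr2.
by rewrite zx /x opprB addrCA subrr addr0 scalerA -rmorphM mulfV ?gt_eqF // scale1r.
Qed.

Lemma sqrt_sub_sqr c (t : R) : star c = c -> 0 < t -> rnorm c <= t ->
  exists s : U, [/\ ustar s = s, s ^+ 2 = (t ^+ 2)%:C%:A - emb c ^+ 2
    & forall u : U, GRing.comm u (emb c) -> GRing.comm u s].
Proof.
move=> sc t0 ct.
pose d : A := (t^-1)%:C *: c.
have dE : emb d = (t^-1)%:C *: emb c by rewrite embZ.
have cE : emb c = t%:C *: emb d.
  by rewrite dE scalerA -rmorphM mulfV ?gt_eqF // scale1r.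
have d1 : bnd (emb d) 1.
  rewrite dE -(@mulVf _ t) ?gt_eqF //; apply: bndZR; first by rewrite invr_ge0 ltW.
  by apply: bnd_le ct _; apply: bnd_emb.
have d2 : bnd (emb d ^+ 2) 1 by rewrite expr2 -[1]mulr1; apply: bndM.
have [|z [z1 z2 zx sz zc]] := @sqrt_1sub R A (emb d ^+ 2) d2.
  by left; rewrite expr2 umul2 mulr0.
have sd : ustar (emb d) = emb d by rewrite dE ustarZ conjR ustar_emb sc.
exists (t%:C *: (1 - z)); split.
- by rewrite ustarZ conjR ustarB ustar1 sz // ustarX sd.
- by rewrite exprZn zx scalerBr -rmorphXn cE exprZn -rmorphXn.
- move=> u uc; apply/commrZ/commrB; first exact: commr1.
  by apply/zc/commrX; rewrite dE; apply: commrZ.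
Qed.

(** With [s = sqrt(t^2 - c^2)], the relation [s^2 + c^2 = t^2] bounds [s] by [t], so
    [t^2 - c^2 = s^2] is bounded by [t^2]. *)
Lemma norm_positive_sqr c : star c = c -> norm_positive (cmul c c).
Proof.
move=> sc; split; first by rewrite starM sc.
pose t := rnorm c + 1; have t0 : 0 < t by have := rnorm_ge0 c; rewrite /t; lra.
have ct : rnorm c <= t by rewrite /t; lra.
have [s [ss s2 s_comm]] := sqrt_sub_sqr sc t0 ct.
have sb : bnd s t.
  apply: (@sum_sqr_bnd _ _ s (emb c)); rewrite ?ltW ?ustar_emb ?sc //.
    by apply/commr_sym/s_comm/commr_refl.
  by rewrite s2 subrK; apply: bnd_real_alg; apply: sqr_ge0.
exists (t ^+ 2); first exact: exprn_gt0.
by rewrite emb_cmul -expr2 -s2 !expr2; apply: bndM.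
Qed.

Lemma cstar_abs c : star c = c -> exists q, [/\ norm_positive q,
  cmul q q = cmul c c
  & forall u : U, GRing.comm u (emb c) -> GRing.comm u (emb q)].
Proof.
move=> sc; have [q [qp qq qc]] := norm_positive_sqrt (norm_positive_sqr sc).
exists q; split=> // u uc; apply: qc.
by rewrite emb_cmul; apply: commrM.
Qed.

(** As [q^2 = c^2], the element [x = q + c] satisfies [x^2 = 2 q x], so its nonzero spectrum lies in
    that of [2 q]. *)
Lemma abs_add_cpositive c q : star c = c -> norm_positive q ->
  cmul q q = cmul c c -> GRing.comm (emb c) (emb q) -> cpositive (q + c).
Proof.
move=> sc qp qq qc; have [sq _] := qp.
have q2 := norm_positive_cpositive (norm_positiveD qp qp).
split=> [|l /spectrumE]; first by rewrite starD sq sc.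
apply: contra_notT => l0; have ln0 : l != 0 by apply: contraNneq l0 => ->.
have qqU : emb q * emb q = emb c * emb c by rewrite -!emb_cmul qq.
have qcq : GRing.comm (emb q + emb c) (emb q).
  by apply/commr_sym/commrD; [apply: commr_refl | apply/commr_sym].
apply: (@sqr_eq_mul_invertible _ _ _ (emb (q + q))) => //; last exact: not_spectrum.
  by rewrite !embD; apply: commrD.
rewrite !embD expr2 !mulrDl; congr (_ + _).
by rewrite !mulrDr qc -qqU addrC.
Qed.

Lemma sa_sub_cpositive c : star c = c ->
  exists p q, [/\ cpositive p, cpositive q & c = (2^-1 : R)%:C *: (p - q)].
Proof.
move=> sc; have [q [qp qq qc]] := cstar_abs sc.
have scN : star (- c) = - c by rewrite starN sc.
have qcc : GRing.comm (emb c) (emb q) by apply/qc/commr_refl.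
exists (q + c), (q - c); split; first exact: abs_add_cpositive.
  apply: abs_add_cpositive => //; last by rewrite embN; apply/commr_sym/commrN/commr_sym.
  by rewrite qq; apply: emb_inj; rewrite !emb_cmul embN mulrNN.
rewrite opprB addrC addrA subrK -mulr2n -[c *+ 2]scaler_nat scalerA.
by rewrite fmorphV rmorph_nat mulVf ?scale1r // pnatr_eq0.
Qed.

(* A spectral gap at 1 makes the norm of [h] less than 1: with
   1 / (1 - h ^ 2) = 1 + a ^ 2 and [T > |a| ^ 2] one gets
   (T + 1) h ^ 2 + (s r) ^ 2 = T, where r ^ 2 = 1 - h ^ 2 and s ^ 2 = T - a ^ 2. *)
Lemma sa_norm_spectrum h : star h = h -> rnorm h = 1 ->
  ~ uinvertible (1 - emb h ^+ 2).
Proof.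
move=> sh h1 [v [mv vm]].
have {}mv : (1 - emb h ^+ 2) * v = 1 by [].
have {}vm : v * (1 - emb h ^+ 2) = 1 by [].
set H := emb h in mv vm *; set m := 1 - H ^+ 2 in mv vm.
have sH : ustar H = H by rewrite ustar_emb sh.
have [|r [sr]] := sqrt_sub_sqr sh (@ltr01 R); first by rewrite h1.
rewrite expr1n scale1r -/H -/m => r2 rc.
have sm : ustar m = m by rewrite ustarB ustar1 ustarX sH.
have inv_comm (u : U) : GRing.comm u m -> GRing.comm u v.
  move=> um; rewrite /GRing.comm -[LHS]mul1r -vm -mulrA (mulrA m) -um.
  by rewrite -(mulrA u) mv mulr1.
have sv : ustar v = v.
  have := congr1 ustar vm; rewrite ustarM sm ustar1 => msv.
  by rewrite -[LHS]mul1r -vm -mulrA msv mulr1.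
have Hm : GRing.comm H m by apply: commrB; [apply: commr1 | apply: commrX].
have Hr : GRing.comm H r by apply: rc.
have rm : GRing.comm r m.
  by rewrite -r2; apply/commrX/commr_refl.
have Hv := inv_comm _ Hm; have rv := inv_comm _ rm.
(* With [r^2 = m] and [v] the inverse of [m], this makes [a^2 = h^2 / (1 - h^2)]. *)
pose a := H * r * v.
have aE : a = emb a.1 by apply: embE; rewrite !umul2 !mul0r.
have sa : star a.1 = a.1.
  apply: emb_inj; rewrite -ustar_emb -aE /a !ustarM sv sr sH -Hr.
  by rewrite mulrA -Hv -mulrA -rv mulrA.
have a2m : a ^+ 2 * m = H ^+ 2.
  rewrite /a !exprMn_comm //; last by apply/commr_sym/commrM; apply/commr_sym.
  by rewrite r2 [v ^+ 2]expr2 -!mulrA vm mulr1 mv mulr1.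
pose t := rnorm a.1 + 1; have t0 : 0 < t by have := rnorm_ge0 a.1; rewrite /t; lra.
have [|s [ss s2 sc]] := sqrt_sub_sqr sa t0; first by rewrite /t; lra.
rewrite -aE in s2 sc.
have Ha : GRing.comm H a by do 2?[apply: commrM => //]; apply: commr_refl.
have ra : GRing.comm r a.
  by do 2?[apply: commrM => //]; apply/commr_sym.
have Hs := sc _ Ha; have rs := sc _ ra.
pose g := Num.sqrt (t ^+ 2 + 1).
have g2 : g ^+ 2 = t ^+ 2 + 1 by rewrite sqr_sqrtr // addr_ge0 ?sqr_ge0.
(* The squares of [g h] and [s r] sum to [t^2]. As [h] has norm 1, the bound forces [g <= t],
   against [g^2 = t^2 + 1]. *)
have : bnd (emb (g%:C *: h)) t.
  apply: (@sum_sqr_bnd _ _ _ (s * r)); first exact: ltW.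
  - by rewrite embZ ustarZ conjR sH.
  - by rewrite ustarM ss sr.
  - by rewrite embZ; apply/commr_sym/commrZ/commr_sym/commrM.
  - rewrite exprMn_comm; last exact/commr_sym.
    rewrite r2 s2 mulrBl a2m mulr_algl embZ exprZn -rmorphXn g2 rmorphD scalerDl.
    rewrite scale1r addrA addrAC addrK -scalerDr /m addrC subrK.
    by apply: bnd_real_alg; apply: sqr_ge0.
move=> /rnorm_le_bnd; rewrite rnormZ h1 mulr1 rnormR ger0_norm ?sqrtr_ge0 //.
rewrite -/g => gt; have := ler_pM (sqrtr_ge0 _) (sqrtr_ge0 _) gt gt.
by rewrite -!expr2 g2; lra.
Qed.

(** Let [q] be the absolute value of [x] and [d = q - x]. If [d] is nonzero, its normalization [h]
    has norm 1, yet [1 + h] is invertible because [d] is positive and [1 - h] because [x] is,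
    against [sa_norm_spectrum]. Hence [x = q]. *)
Lemma cpositive_norm_positive x : cpositive x -> norm_positive x.
Proof.
move=> xp; have [sx _] := xp; have [q [qp qq qc]] := cstar_abs sx.
have xq : GRing.comm (emb x) (emb q) by apply/qc/commr_refl.
have [qx0|qx0] := eqVneq (q - x) 0; first by rewrite -(subr0_eq qx0).
set d := q - x in qx0.
have dp : cpositive d.
  apply: abs_add_cpositive => //.
  - by rewrite starN sx.
  - by rewrite qq; apply: emb_inj; rewrite !emb_cmul embN mulrNN.
  - by rewrite embN; apply/commr_sym/commrN/commr_sym.
pose n := rnorm d.
have n0 : 0 < n.
  rewrite lt_neqAle rnorm_ge0 andbT eq_sym; apply: contraNneq qx0 => n0.
  by apply/eqP/rnorm_le0; rewrite -/n n0.
have nC : n%:C != 0 by rewrite -(rmorph0 (real_complex R)) (inj_eq (@complexI R)) gt_eqF.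
pose h : A := (n^-1)%:C *: d.
have [sd _] := dp.
have sh : star h = h by rewrite starZ conjR sd.
have h1 : rnorm h = 1.
  by rewrite rnormZ rnormR ger0_norm ?mulVf ?gt_eqF // invr_ge0 ltW.
have hE (e : R) : 1 - e%:C *: emb h = (n^-1)%:C *: (n%:C%:A - e%:C *: emb d).
  rewrite scalerBr scalerA -rmorphM mulVf ?gt_eqF // scale1r embZ.
  by rewrite scalerA mulrC -scalerA.
have nV : (n^-1)%:C != 0 by rewrite fmorphV invr_eq0.
case: (sa_norm_spectrum sh h1).
have -> : 1 - emb h ^+ 2 = (1 - emb h) * (1 + emb h).
  by rewrite -subr_sqr_comm ?expr1n //; apply/commr_sym/commr1.
apply: uinvertibleM.
  rewrite -[emb h]scale1r (hE 1) scale1r; apply: uinvertibleZ => //.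
  (* From [q^2 = x^2] follows [d^2 = - 2 x d], so [n] in the spectrum of [d] would put [- n / 2] in
     that of [x]. *)
  apply: (@sqr_eq_mul_invertible _ _ _ (emb (- (x + x)))) => //.
  - have dx : GRing.comm (emb d) (emb x).
      by rewrite embB; apply/commr_sym/commrB => //; apply: commr_refl.
    by rewrite embN embD; apply/commrN/commrD.
  - have qqU : emb q * emb q = emb x * emb x by rewrite -!emb_cmul qq.
    rewrite embN embD embB expr2 mulNr -mulrN opprB !mulrBl !mulrDl !mulrBr.
    by rewrite qqU -xq opprB addrACA.
  - have -> : n%:C%:A - emb (- (x + x)) =
              (- 2) *: ((- (n / 2))%:C%:A - emb x).
      rewrite embN embD opprK scalerBr [_ *: emb x]scaleNr opprK.
      rewrite [2 *: emb x]scaler_nat mulr2n; congr (_ + _).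
      rewrite scalerA rmorphN mulrNN rmorphM fmorphV rmorph_nat.
      by rewrite mulrCA mulfV ?mulr1 // (pnatr_eq0 _ 2).
    apply: uinvertibleZ; first by rewrite oppr_eq0 pnatr_eq0.
    apply: not_spectrum => //; rewrite lecE /= eqxx /= -ltNge.
    by rewrite oppr_lt0 divr_gt0.
have -> : 1 + emb h = - (n^-1)%:C *: ((- n)%:C%:A - emb d).
  rewrite -[emb h]opprK -[- emb h]scaleN1r -(rmorphN1 (real_complex R)) hE.
  by rewrite rmorphN1 scaleN1r opprK scaleNr -scalerN opprB rmorphN scaleNr opprK addrC.
apply: uinvertibleZ; first by rewrite oppr_eq0.
apply: not_spectrum => //; rewrite lecE /= eqxx /= -ltNge.
by rewrite oppr_lt0.
Qed.

Lemma cpositive_sqrt x : cpositive x ->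
  exists2 p : A, cpositive p & cmul p p = x.
Proof.
move=> /cpositive_norm_positive/norm_positive_sqrt[p [pp ppx _]].
by exists p => //; apply: norm_positive_cpositive.
Qed.

End Positive.

(** * n-multiplicative maps *)

Lemma prodr_nseq (S : pzSemiRingType) (X : Type) (g : X -> S) (k : nat) (x : X) :
  \prod_(y <- nseq k x) g y = g x ^+ k.
Proof. by elim: k => [|k IH]; rewrite /= ?big_nil // big_cons IH exprS. Qed.

Section NMultiplicative.
(** [S] and [T] will be unitizations and [I] the ideal [A], so that powers and iterated products are
    those of a unital ring; [N.+1] is the [n] of the theorem. *)
Variables (S T : pzRingType) (I : S -> Prop) (N : nat) (f : S -> T).
Hypothesis I_mul : forall x y, I x -> I y -> I (x * y).
Hypothesis N_gt0 : (0 < N)%N.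
Hypothesis f_prod : forall s : seq S, size s = N.+1 ->
  (forall x, x \in s -> I x) -> f (\prod_(x <- s) x) = \prod_(x <- s) f x.

Lemma closed_prod (s : seq S) : s != [::] -> (forall x, x \in s -> I x) ->
  I (\prod_(x <- s) x).
Proof.
elim: s => [//|x [|y s] IH] _ Is; first by rewrite big_seq1; apply/Is/mem_head.
rewrite big_cons; apply: I_mul; first exact/Is/mem_head.
by apply: IH => // z zs; apply: Is; rewrite inE zs orbT.
Qed.

Lemma closed_exp (x : S) (k : nat) : (0 < k)%N -> I x -> I (x ^+ k).
Proof.
case: k => // k _ Ix; rewrite -(prodr_nseq id); apply: closed_prod => // y.
by rewrite mem_nseq => /andP[_ /eqP->].
Qed.

(** Merging the first [N.+1] factors into one lowers the length by [N]. *)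
Lemma nmult_prod (j : nat) (s : seq S) : size s = (j * N).+1 ->
  (forall x, x \in s -> I x) -> f (\prod_(x <- s) x) = \prod_(x <- s) f x.
Proof.
elim: j s => [|j IH] s sz Is.
  by case: s sz {Is} => [//|x [|//]] _; rewrite !big_seq1.
have nle : (N.+1 <= size s)%N by rewrite sz mulSn ltnS leq_addr.
have sz1 : size (take N.+1 s) = N.+1 by rewrite size_takel.
pose p := \prod_(x <- take N.+1 s) x.
have -> : \prod_(x <- s) x = \prod_(x <- p :: drop N.+1 s) x.
  by rewrite big_cons -big_cat cat_take_drop.
rewrite IH.
- by rewrite big_cons f_prod -?big_cat ?cat_take_drop // => x /mem_take; apply: Is.
- by rewrite /= size_drop sz mulSn -addSn addKn.
move=> x; rewrite inE => /predU1P[->|/mem_drop]; last exact: Is.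
apply: closed_prod; first by rewrite -size_eq0 sz1.
by move=> y /mem_take; apply: Is.
Qed.

(** Inserting [l ^+ j] at any place among [N] factors [l] gives the same product. Hence its image
    can be moved through [f l ^+ N], then through [f l ^+ N.+1 = f (l ^+ N.+1)]. *)
Lemma nmult_comm_exp (l : S) (j : nat) : I l -> (0 < j)%N ->
  GRing.comm (f (l ^+ N.+1)) (f (l ^+ j)).
Proof.
move=> Il j0; have Ij := closed_exp j0 Il; set X := f (l ^+ j).
have Is (a b : nat) : forall x, x \in nseq a l ++ l ^+ j :: nseq b l -> I x.
  move=> x; rewrite mem_cat inE !mem_nseq.
  by case/orP => [/andP[_ /eqP->]|/predU1P[->|/andP[_ /eqP->]]].
have fE (a b : nat) : (a + b)%N = N -> f l ^+ a * X * f l ^+ b = f (l ^+ (N + j)).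
  move=> ab; have := f_prod (s := nseq a l ++ l ^+ j :: nseq b l).
  rewrite size_cat /= !size_nseq addnS ab => /(_ erefl (Is a b)).
  rewrite !big_cat !big_cons !prodr_nseq /= -/X => h; rewrite -mulrA -h.
  congr f; rewrite -!exprD; congr (_ ^+ _); lia.
have -> : f (l ^+ N.+1) = f l ^+ N.+1.
  rewrite -(prodr_nseq id) f_prod ?size_nseq ?prodr_nseq // => x.
  by rewrite mem_nseq => /andP[_ /eqP->].
rewrite /GRing.comm exprS -mulrA.
have -> : f l ^+ N * X = X * f l ^+ N.
  by rewrite -[LHS]mulr1 (fE N 0%N) ?addn0 // -(fE 0%N N) // mul1r.
rewrite mulrA; have [M NM] : {M | N = M.+1} by exists N.-1; rewrite prednK.
rewrite {1}NM exprSr mulrA (fE 1%N M) ?NM // -NM -(fE 0%N N) // mul1r.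
by rewrite -!mulrA -exprSr -exprS.
Qed.

(** Both sides are the image of [k^(2N+1)], split into [N] squares and one [k], or into [2N+1]
    factors [k]. *)
Lemma nmult_sqr_exp (k : S) : I k ->
  f (k ^+ 2) ^+ N * f k = f k ^+ (N + N).+1.
Proof.
move=> Ik; have Ik2 := closed_exp (isT : (0 < 2)%N) Ik.
have <- : f (k ^+ (N + N).+1) = f k ^+ (N + N).+1.
  rewrite -(prodr_nseq id) (@nmult_prod 2) ?size_nseq ?prodr_nseq //; first lia.
  by move=> x; rewrite mem_nseq => /andP[_ /eqP->].
have := f_prod (s := nseq N (k ^+ 2) ++ [:: k]).
rewrite size_cat /= addn1 size_nseq !big_cat !big_seq1 !prodr_nseq /= => <- //;
  last first.
  move=> x; rewrite mem_cat inE mem_nseq.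
  by case/orP => [/andP[_ /eqP->]|/eqP->].
by congr f; rewrite -exprM -exprSr; congr (_ ^+ _); lia.
Qed.

(* The factor [k ^ (3N)] gives room to compare [x, k^2, k, ..., k, z] with
   [x] and [k, ..., k, z]. *)
Lemma nmult_mul_exp (x k z : S) : I x -> I k -> I z ->
  f (k ^+ 2) * f k ^+ N = f k ^+ N.+2 ->
  f (x * (k ^+ (3 * N) * z)) = f x * f (k ^+ (3 * N) * z).
Proof.
move=> Ix Ik Iz e; have Ik2 := closed_exp (isT : (0 < 2)%N) Ik.
have -> : f (k ^+ (3 * N) * z) = f k ^+ (3 * N) * f z.
  have := @nmult_prod 3 (nseq (3 * N) k ++ [:: z]).
  rewrite size_cat /= addn1 size_nseq !big_cat !big_seq1 !prodr_nseq /=; apply => //.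
  move=> y; rewrite mem_cat inE mem_nseq.
  by case/orP => [/andP[_ /eqP->]|/eqP->].
(* The factors [x], [k^2], [3N - 2] copies of [k], and [z] number [3N + 1]. *)
have := @nmult_prod 3 (x :: k ^+ 2 :: nseq (3 * N - 2) k ++ [:: z]).
rewrite /= size_cat /= addn1 size_nseq !big_cons !big_cat !big_seq1 !prodr_nseq /=.
have -> : k ^+ 2 * (k ^+ (3 * N - 2) * z) = k ^+ (3 * N) * z.
  by rewrite mulrA -exprD; congr (_ ^+ _ * _); lia.
have -> : f (k ^+ 2) * (f k ^+ (3 * N - 2) * f z) = f k ^+ (3 * N) * f z.
  (* As [N >= 1], there are [N] factors [f k] next to [f (k ^+ 2)] to apply [e]. *)
  have -> : (3 * N - 2 = N + (2 * N - 2))%N by lia.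
  by rewrite exprD !mulrA e -exprD; congr (_ ^+ _ * _); lia.
apply; first lia.
move=> y; rewrite !inE mem_cat inE mem_nseq.
by case/or4P => [/eqP->|/eqP->|/andP[_ /eqP->]|/eqP->].
Qed.

End NMultiplicative.

(** * Uniqueness of positive roots *)

Section Cancellation.
Context {R : realType} {A : cstarAlgType R}.
Local Notation U := (unitization A).

(** With [p] the square root of [q], the equation reads [x^2 + p^2 = 0], and [sum_sqr_bnd] applies
    with bound 0. *)
Lemma sqr_add_positive_eq0 (x q : A) : star x = x -> norm_positive q ->
  GRing.comm (emb x) (emb q) -> emb x ^+ 2 + emb q = 0 -> x = 0.
Proof.
move=> sx qp xq xq0; have [p [[sp _] pp pc]] := norm_positive_sqrt qp.
apply/rnorm_le0/rnorm_le_bnd; apply: (@sum_sqr_bnd _ _ _ (emb p)) => //.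
- by rewrite ustar_emb sx.
- by rewrite ustar_emb sp.
- exact: pc.
rewrite [emb p ^+ 2]expr2 -emb_cmul pp xq0 -emb0 expr2 mul0r -(@rnorm0 _ A).
exact: bnd_emb.
Qed.

Lemma sum_sqr_positive (J : Type) (s : seq J) (x : J -> A) :
  (forall j, star (x j) = x j) ->
  norm_positive (\sum_(j <- s) cmul (x j) (x j)).
Proof.
move=> sx; apply: big_ind => [||j _]; first exact: norm_positive0.
  exact: norm_positiveD.
exact: norm_positive_sqr.
Qed.

(* Uniqueness of positive N-th roots for commuting elements: with
   w = (q^2 - l^2) l, the terms of \sum_i (q^(N-1-i) l^i w)^2 are squares of
   self-adjoint elements and their sum vanishes, so each term vanishes. *)
Lemma positive_root_cancel (q l : A) (N : nat) : (0 < N)%N ->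
  star q = q -> star l = l -> GRing.comm (emb q) (emb l) ->
  (emb q ^+ 2) ^+ N * emb l = emb l ^+ (N + N).+1 ->
  emb q ^+ 2 * emb l ^+ N = emb l ^+ N.+2.
Proof.
case: N => // N _ sq sl ql e.
set Q := emb q in ql e *; set L := emb l in ql e *.
have sQ : ustar Q = Q by rewrite ustar_emb sq.
have sL : ustar L = L by rewrite ustar_emb sl.
pose D := Q ^+ 2 - L ^+ 2; pose W := D * L.
have comm_all (u : U) : GRing.comm u Q -> GRing.comm u L -> GRing.comm u W.
  by move=> uQ uL; apply: commrM => //; apply: commrB; apply: commrX.
have QQ := commr_refl Q; have LL := commr_refl L; have lq := commr_sym ql.
have QW : GRing.comm Q W by apply: comm_all.
have LW : GRing.comm L W by apply: comm_all.
have sD : ustar D = D by rewrite ustarB !ustarX sQ sL.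
have LD : GRing.comm L D by apply: commrB; apply: commrX.
have sW : ustar W = W by rewrite ustarM sD sL LD.
pose X (i : nat) := Q ^+ (N - i) * L ^+ i * W.
have sX i : ustar (X i) = X i.
  rewrite /X ustarM sW ustarM !ustarX sQ sL.
  have -> : L ^+ i * Q ^+ (N - i) = Q ^+ (N - i) * L ^+ i.
    by apply: commrX; apply/commr_sym/commrX.
  by apply: commrM; apply: commrX; apply/commr_sym.
have XE i : emb (X i).1 = X i by rewrite -embE // umul2 [W.2]umul2 !mulr0.
have Xcomm (u : U) i : GRing.comm u Q -> GRing.comm u L -> GRing.comm u (X i).
  by move=> uQ uL; apply: commrM; [apply: commrM; apply: commrX | apply: comm_all].
have XX i j : GRing.comm (X i) (X j).
  by apply/Xcomm; apply/commr_sym/Xcomm.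
have X2 i : X i ^+ 2 = Q ^+ 2 ^+ (N - i) * L ^+ 2 ^+ i * W ^+ 2.
  have QiLi : GRing.comm (Q ^+ (N - i)) (L ^+ i).
    by apply: commrX; apply/commr_sym/commrX.
  have QLW : GRing.comm (Q ^+ (N - i) * L ^+ i) W.
    by apply/commr_sym/commrM; apply/commrX/commr_sym.
  rewrite /X (exprMn_comm 2 QLW) (exprMn_comm 2 QiLi).
  by rewrite -!exprM !(mulnC 2%N).
have sum0 : \sum_(i < N.+1) X i ^+ 2 = 0.
  have Q2L2 : GRing.comm (Q ^+ 2) (L ^+ 2).
    by apply: commrX; apply/commr_sym/commrX.
  (* The sum is the cofactor of [D] in [Q^(2(N+1)) - L^(2(N+1))], and [e] says that this difference
     times [L] vanishes. *)
  have e0 : D * (\sum_(i < N.+1) Q ^+ 2 ^+ (N.+1.-1 - i) * L ^+ 2 ^+ i) * L = 0.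
    rewrite -subrXX_comm // mulrBl e -exprM -exprSr.
    by rewrite (_ : (2 * N.+1)%N = (N.+1 + N.+1)%N) ?subrr //; lia.
  set S := \sum_(i < _) _ in e0.
  have DS : GRing.comm D S.
    apply: commr_sum => i _; apply: commrM; apply: commrX; apply: commrX.
      by apply/commr_sym/commrB; apply: commrX.
    exact/commr_sym.
  transitivity (S * W ^+ 2); last by rewrite expr2 /W !mulrA -DS e0 !mul0r.
  by rewrite /S mulr_suml; apply: eq_bigr => i _; rewrite X2.
(* The last term suffices: [X N = L^N W], and its vanishing is the claim. The other squares form the
   positive [q']. *)
have XN0 : (X N).1 = 0.
  pose q' := \sum_(i < N) cmul (X i).1 (X i).1.
  have q'E : emb q' = \sum_(i < N) X i ^+ 2.
    rewrite /q' raddf_sum /=; apply: eq_bigr => i _.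
    by rewrite -[LHS]/(emb (cmul _ _)) emb_cmul XE expr2.
  apply: (@sqr_add_positive_eq0 _ q').
  - by apply: emb_inj; rewrite -ustar_emb XE sX.
  - by apply: sum_sqr_positive => i; apply: emb_inj; rewrite -ustar_emb XE sX.
  - by rewrite XE q'E; apply: commr_sum => i _; apply: commrX.
  - by rewrite XE q'E -[RHS]sum0 big_ord_recr /= addrC.
have : X N = 0 by rewrite -XE XN0.
rewrite /X subnn mul1r /W mulrA; have -> : L ^+ N * D = D * L ^+ N.
  by apply/commr_sym/commrX/commr_sym.
rewrite -mulrA -exprSr mulrBl -exprD => /subr0_eq.
by rewrite add2n.
Qed.
End Cancellation.

(** * Linear extension from positive elements *)

Section Homomorphisms.
Context {R : realType} {A B : cstarAlgType R}.
Variable phi : A -> B.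
Hypothesis phi_linear : linear phi.

Lemma lin_map0 : phi 0 = 0.
Proof. by have := phi_linear (-1) 0 0; rewrite scaler0 addr0 scaleN1r addNr. Qed.

Lemma lin_mapZ c x : phi (c *: x) = c *: phi x.
Proof. by have := phi_linear c x 0; rewrite !addr0 lin_map0 addr0. Qed.

Lemma lin_mapD x y : phi (x + y) = phi x + phi y.
Proof. by have := phi_linear 1 x y; rewrite !scale1r. Qed.

Lemma lin_mapN x : phi (- x) = - phi x.
Proof. by rewrite -scaleN1r lin_mapZ scaleN1r. Qed.

Lemma sa_decomposition (x : A) : exists h k : A,
  [/\ star h = h, star k = k & x = h + 'i *: k].
Proof.
pose c : R[i] := (2^-1 : R)%:C.
have cc : c + c = 1 by rewrite /c -rmorphD /= (_ : 2^-1 + 2^-1 = 1) //; field.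
have ii : 'i * (- 'i) = 1 :> R[i] by rewrite mulrN -expr2 sqrCi opprK.
exists (c *: (x + star x)), ((- 'i * c) *: (x - star x)); split.
- by rewrite starZ conjR starD starK addrC.
- rewrite starZ rmorphM rmorphN /= conjCi opprK conjR starD starN starK.
  by rewrite mulNr scaleNr -scalerN opprB.
- rewrite scalerA mulrA ii mul1r -scalerDr addrACA subrr addr0.
  by rewrite -mulr2n -[x *+ 2]scaler_nat scalerA mulr_natr mulr2n cc scale1r.
Qed.

Lemma positive_star : (forall a, cpositive a -> cpositive (phi a)) ->
  forall x, phi (star x) = star (phi x).
Proof.
move=> pos; have sa h : star h = h -> star (phi h) = phi h.
  move=> /sa_sub_cpositive[p [q [/pos[sp _] /pos[sq _] ->]]].
  by rewrite lin_mapZ lin_mapD lin_mapN starZ conjR starD starN sp sq.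
move=> x; have [h [k [sh sk ->]]] := sa_decomposition x.
by rewrite starD starZ sh sk !lin_mapD !lin_mapZ starD starZ !sa.
Qed.

Lemma multiplicative_of_cpositive :
  (forall x y, cpositive y -> phi (cmul x y) = cmul (phi x) (phi y)) ->
  forall x y, phi (cmul x y) = cmul (phi x) (phi y).
Proof.
move=> pos x; have sa h : star h = h -> phi (cmul x h) = cmul (phi x) (phi h).
  move=> /sa_sub_cpositive[p [q [pp pq ->]]].
  rewrite -cscalerAr !lin_mapZ -cscalerAr -scaleN1r; congr (_ *: _).
  by rewrite cmulDr -cscalerAr !lin_mapD !lin_mapZ cmulDr -cscalerAr !pos.
move=> y; have [h [k [sh sk ->]]] := sa_decomposition y.
by rewrite cmulDr -cscalerAr !lin_mapD !lin_mapZ cmulDr -cscalerAr !sa.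
Qed.

End Homomorphisms.

Section CProd.
Context {R : realType} {A : cstarAlgType R}.

Lemma emb_cprod (s : seq A) : s != [::] ->
  emb (cprod s) = \prod_(x <- s) emb x.
Proof.
case: s => // a s _; rewrite /= big_cons; elim: s a => [|b s IH] a.
  by rewrite big_nil mulr1.
by rewrite /= IH emb_cmul big_cons mulrA.
Qed.

Lemma cpositive_root2 (x : A) (j : nat) : cpositive x ->
  exists2 l : A, cpositive l & emb l ^+ (2 ^ j) = emb x.
Proof.
move=> xp; elim: j => [|j [l lp <-]]; first by exists x.
have [p pp ppl] := cpositive_sqrt lp; exists p => //.
by rewrite expnS exprM expr2 -emb_cmul ppl.
Qed.

End CProd.

(** * Multiplicativity of positive n-homomorphisms *)

Section PositiveNHomomorphism.
Context {R : realType} {A B : cstarAlgType R}.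
Variables (N : nat) (phi : A -> B).
Hypotheses (N_gt0 : (0 < N)%N) (phi_linear : linear phi).
Hypothesis phi_pos : forall a : A, cpositive a -> cpositive (phi a).
Hypothesis phi_nhom : forall a : N.+1.-tuple A,
  phi (cprod a) = cprod [seq phi x | x <- a].

Let f (u : unitization A) : unitization B := emb (phi u.1).
Let I (u : unitization A) : Prop := u.2 = 0.

Lemma ideal_mul (x y : unitization A) : I x -> I y -> I (x * y).
Proof. by rewrite /I umul2 => -> _; rewrite mul0r. Qed.

Lemma nhom_prod (s : seq (unitization A)) : size s = N.+1 ->
  (forall x, x \in s -> I x) -> f (\prod_(x <- s) x) = \prod_(x <- s) f x.
Proof.
move=> sz Is; pose t := [seq x.1 | x <- s].
have szt : size t == N.+1 by rewrite size_map sz.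
have st : s = [seq emb x | x <- t].
  by rewrite -map_comp -[LHS]map_id; apply/eq_in_map => x /Is/embE.
have t0 : t != [::] by rewrite -size_eq0 (eqP szt).
rewrite [in LHS]st big_map -emb_cprod // /f /= (phi_nhom (Tuple szt)) /=.
rewrite emb_cprod; last by rewrite -size_eq0 size_map (eqP szt).
by rewrite !big_map.
Qed.

Lemma positive_nhom_mul (x y : A) : cpositive y ->
  phi (cmul x y) = cmul (phi x) (phi y).
Proof.
(* [j] is the exponent of [l] in [k^m]; as [j < 2^j], the power [l^(2^j) = y] splits as [k^m z] with
   [z] a nontrivial power of [l]. *)
move=> yp; pose m := (3 * N)%N; pose j := (N.+1 * m)%N.
have [l lp ly] := cpositive_root2 j yp; have [sl _] := lp.
pose k := emb l ^+ N.+1.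
have Il : I (emb l) by [].
have Ik : I k by apply: (closed_exp ideal_mul).
have jlt : (j < 2 ^ j)%N by apply: ltn_expl.
pose z := emb l ^+ (2 ^ j - j).
have Iz : I z by apply: (closed_exp ideal_mul) => //; rewrite subn_gt0.
have kzy : k ^+ m * z = emb y.
  by rewrite /k /z -exprM -exprD subnKC // ltnW.
have sk : star k.1 = k.1.
  by apply: emb_inj; rewrite -ustar_emb -embE // ustarX ustar_emb sl.
have k2 : k ^+ 2 = emb (cmul k.1 k.1) by rewrite emb_cmul -embE.
have phi_sa (h : A) : star h = h -> star (phi h) = phi h.
  by move=> sh; rewrite -(positive_star phi_linear phi_pos) sh.
have Yp : cpositive (phi (k ^+ 2).1).
  by rewrite k2; apply/phi_pos/norm_positive_cpositive/norm_positive_sqr.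
(* Writing [f (k ^+ 2)] as the square of [emb q] puts [nmult_sqr_exp] in the form required by
   [positive_root_cancel]. *)
have [q [[sq _] qq qc]] := norm_positive_sqrt (cpositive_norm_positive Yp).
have Q2 : emb q ^+ 2 = f (k ^+ 2) by rewrite expr2 -emb_cmul qq.
have comm_kk2 : GRing.comm (f k) (f (k ^+ 2)).
  by rewrite -exprM; apply: (nmult_comm_exp ideal_mul N_gt0 nhom_prod).
have := @positive_root_cancel _ _ q (phi k.1) N N_gt0 sq (phi_sa _ sk).
rewrite Q2 => /(_ (commr_sym (qc _ comm_kk2))).
rewrite (nmult_sqr_exp ideal_mul N_gt0 nhom_prod Ik) => /(_ erefl) cancel.
apply: emb_inj; rewrite emb_cmul.
have := nmult_mul_exp ideal_mul N_gt0 nhom_prod (x := emb x) erefl Ik Iz cancel.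
by rewrite -/m kzy -!emb_cmul.
Qed.

End PositiveNHomomorphism.

(** The unital extension of [phi] to the unitizations carries an inverse of [c - a] to one of
    [c - phi a], so the spectrum can only shrink. *)
Lemma star_hom_cpositive (R : realType) (A B : cstarAlgType R) (phi : A -> B) :
  star_homomorphism phi -> forall a, cpositive a -> cpositive (phi a).
Proof.
move=> [lin mul st] a [sa pa]; split=> [|c]; first by rewrite -st sa.
move=> hc; apply: pa => -[v [v1 v2]]; apply: hc.
exists (phi v.1, v.2); move: v1 v2 => [e1 e2] [g1 g2].
by split; (apply: injective_projections => /=; last by []);
   rewrite -(lin_mapN lin) -mul -!(lin_mapZ lin) -!(lin_mapD lin) ?e1 ?g1 (lin_map0 lin).
Qed.

Theorem corollary4p8 (R : realType) (n : nat) (hn : (2 <= n)%N)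
    (A B : cstarAlgType R) (phi : A -> B) :
  (positive_map phi /\ n_homomorphism n phi) <-> star_homomorphism phi.
Proof.
split=> [[[lin pos] [_ nhom]]|hom].
  case: n hn nhom => // N N_gt0 nhom; split=> //; last exact: positive_star.
  apply: multiplicative_of_cpositive => // x y yp.
  exact: (positive_nhom_mul (N := N)).
have [lin mul st] := hom; split; first by split=> //; apply: star_hom_cpositive.
(* On the empty sequence both products are the dummy 0, which [phi] fixes by linearity. *)
split=> // a; case: (tval a) => [|x s] /=; first exact: (lin_map0 lin).
by elim: s x => //= y s IH x; rewrite IH mul.
Qed.
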